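(* Let $d,k$ be positive integers. (a) $\displaystyle \operatorname{off}_\mathbb{R}(d,k)\geq \frac{1}{\alpha_k(d+k)-1}$, where $\alpha_k=\frac{(k-1)\sqrt{k+2}+2}{k(k+1)}$. If equality holds, then there exists a system of $\binom{k+1}{2}$ equiangular lines in $\mathbb{R}^k$ and $d\equiv -k \pmod{\binom{k+1}{2}}$. (b) $\displaystyle \operatorname{off}_\mathbb{C}(d,k)\geq \frac{1}{\alpha^*_k(d+k)-1}$, where $\alpha^*_k=\frac{(k-1)\sqrt{k+1}+1}{k^2}$. If equality holds, then there exists a system of $k^2$ equiangular lines in $\mathbb{C}^k$ and $d\equiv -k\pmod{k^2}$.
   Context: Let $\mathbb{F}\in\{\mathbb{R},\mathbb{C}\}$. For a matrix $A\in\mathbb{F}^{n\times n}$, $\operatorname{off}(A):=\max_{i\neq j}|A_{ij}|$. For positive integers $d,k$, $\operatorname{off}_\mathbb{F}(d,k):=\min_A \operatorname{off}(A)$, the minimum over all $A\in\mathbb{F}^{(d+k)\times(d+k)}$ with $\operatorname{rank}(A)=d$ and $A_{ii}=1$ for all $i$. A system of equiangular lines in $\mathbb{F}^k$ is a set $X$ of unit vectors in $\mathbb{F}^k$ for which there is $\beta\in\mathbb{R}$ with $|\langle x,y\rangle|=\beta$ for all distinct $x,y\in X$. *)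

(* Defs.v *)
From HB Require Import structures.
From mathcomp Require Import all_boot all_order all_algebra.
From mathcomp Require Import complex.
From mathcomp Require Import all_classical all_reals all_analysis.
From mathcomp Require Import lra.

Set Implicit Arguments.
Unset Strict Implicit.
Unset Printing Implicit Defensive.

Import Order.TTheory GRing.Theory Num.Theory numFieldNormedType.Exports.

Local Open Scope classical_set_scope.
Local Open Scope ring_scope.

(* The modulus [absF] takes its values in [R] also when the entries are
   complex: the norm [`|z|] of [z : R[i]] is itself an element of [R[i]]. *)
Section GenericField.
Variables (R : realType) (F : fieldType) (absF : F -> R) (cjF : F -> F).

Definition offmx n (A : 'M[F]_n) : R :=
  \big[Num.max/0]_(p : 'I_n * 'I_n | p.1 != p.2) absF (A p.1 p.2).

Definition admissible d k : set 'M[F]_(d + k) :=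
  [set A | \rank A = d /\ forall i, A i i = 1].

(* The infimum is attained when [d] is positive: see [offR_min] and [offC_min]. *)
Definition off_gen d k : R := inf [set offmx A | A in @admissible d k].

Definition dotF k (x y : 'rV[F]_k) : F := \sum_(i < k) x 0 i * cjF (y 0 i).

(* The second clause says that distinct elements of [X] span distinct lines.
   Without it, the choice beta = 1 and the unit multiples of a single vector
   would give arbitrarily large systems over the complex numbers. *)
Definition equiangular_gen k (X : set 'rV[F]_k) : Prop :=
  [/\ forall x, X x -> dotF x x = 1,
      forall x y, X x -> X y -> x <> y -> ~~ (x == y)%MS
    & exists beta : R,
        forall x y, X x -> X y -> x <> y -> absF (dotF x y) = beta].

End GenericField.

Section RealAndComplex.
Variable R : realType.

Definition offR d k : R := off_gen (fun x : R => `|x|) d k.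
Definition offC d k : R := off_gen (@Normc.normc R) d k.

Definition equiangularR k (X : set 'rV[R]_k) : Prop :=
  equiangular_gen (fun x : R => `|x|) id X.
Definition equiangularC k (X : set 'rV[R[i]]_k) : Prop :=
  equiangular_gen (@Normc.normc R) conjc X.

Definition alphaR k : R :=
  ((k%:R - 1) * Num.sqrt (k%:R + 2) + 2) / (k%:R * (k%:R + 1)).
Definition alphaC k : R :=
  ((k%:R - 1) * Num.sqrt (k%:R + 1) + 1) / k%:R ^+ 2.

End RealAndComplex.

Arguments offR : clear implicits.
Arguments offC : clear implicits.
Arguments alphaR : clear implicits.
Arguments alphaC : clear implicits.

Section Minimum.
Variables (R : realType) (F : fieldType) (absF : F -> R).
Hypothesis absM : forall x y, absF (x * y) = absF x * absF y.
Hypothesis absD : forall x y, absF (x + y) <= absF x + absF y.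
Hypothesis absN : forall x, absF (- x) = absF x.
Hypothesis abs_nat : forall n, absF n%:R = n%:R.
Hypothesis abs0_eq0 : forall x, absF x = 0 -> x = 0.

Let abs0 : absF 0 = 0. Proof. exact: (abs_nat 0). Qed.
Let abs1 : absF 1 = 1. Proof. exact: (abs_nat 1). Qed.
Let abs_ge0 x : 0 <= absF x.
Proof. by have := absD x (- x); rewrite subrr abs0 absN; lra. Qed.
Let natF_eq0 n : (n%:R == 0 :> F) = (n == 0)%N.
Proof.
apply/eqP/eqP => [n0|->//]; apply/eqP; rewrite -(@pnatr_eq0 R) -abs_nat.
by rewrite n0 abs0.
Qed.
Let natF_inj : injective (fun n => n%:R : F).
Proof.
move=> m n; wlog mn : m n / (m <= n)%N.
  by move=> H E; case/orP: (leq_total m n) => ?; [|apply/esym]; apply: H.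
move=> /eqP; rewrite eq_sym -subr_eq0 -natrB// natF_eq0 subn_eq0 => nm.
by apply/eqP; rewrite eqn_leq mn.
Qed.

Lemma offmx_le n (A : 'M[F]_n) c :
  0 <= c -> (offmx absF A <= c) <-> (forall i j, i != j -> absF (A i j) <= c).
Proof.
move=> c0; split=> [/bigmax_leP[_ H] i j ij|H]; first exact: (H (i, j)).
by apply/bigmax_leP; split=> // -[i j]; exact: H.
Qed.

Lemma offmx_ge0 n (A : 'M[F]_n) : 0 <= offmx absF A.
Proof. by rewrite /offmx; elim/big_rec: _ => // p x _ x0; rewrite le_max x0 orbT. Qed.

Lemma le_offmx n (A B : 'M[F]_n) :
  (forall i j, i != j -> absF (A i j) <= absF (B i j)) ->
  offmx absF A <= offmx absF B.
Proof.
move=> AB; apply/offmx_le => [|i j ij]; first exact: offmx_ge0.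
apply: le_trans (AB _ _ ij) _.
by have [+ _] := offmx_le B (offmx_ge0 B); apply.
Qed.

Lemma exists_shift n (A : 'M[F]_n) : exists m, A + m%:R%:M \in unitmx.
Proof.
apply: contrapT => noU.
have char_root m : root (char_poly (- A)) m%:R.
  rewrite -eigenvalue_root_char /eigenvalue /eigenspace kermx_eq0.
  apply/negP => U; apply: noU; exists m; rewrite -row_free_unit /row_free.
  by rewrite -mxrank_opp opprD.
have := @max_poly_roots _ (char_poly (- A)) [seq m%:R | m <- iota 0 n.+1].
rewrite size_char_poly size_map size_iota ltnn => H.
have : false.
  apply: H.
  - by rewrite -size_poly_gt0 size_char_poly.
  - by apply/allP => _ /mapP[m _ ->].
  - by rewrite map_inj_uniq ?iota_uniq.
by [].
Qed.

Lemma raise_rank n d (A : 'M[F]_n) : (\rank A <= d <= n)%N ->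
  (forall i, A i i = 1) ->
  exists B : 'M[F]_n,
    [/\ \rank B = d, forall i, B i i = 1 & offmx absF B <= offmx absF A].
Proof.
move=> /andP[rA dn] A1; have [m Um] := exists_shift A.
pose dg j : 'rV[F]_n := \row_i ((i < j)%N%:R * m%:R).
pose B j := A + diag_mx (dg j).
have B0 : B 0 = A.
  by rewrite /B; apply/matrixP => i k; rewrite !mxE ltn0 mul0r mul0rn addr0.
have Bn : \rank (B n) = n.
  rewrite mxrank_unit //; suff -> : B n = A + m%:R%:M by [].
  by apply/matrixP => i k; rewrite !mxE ltn_ord mul1r.
have BS j : (j < n)%N -> (\rank (B j.+1) <= (\rank (B j)).+1)%N.
  move=> jn; have -> : B j.+1 = B j + m%:R *: delta_mx (Ordinal jn) (Ordinal jn).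
    apply/matrixP => i k; rewrite !mxE -addrA; congr (_ + _).
    have [<-|ik] := eqVneq i k; last first.
      rewrite !mulr0n add0r -!val_eqE/=.
      case: eqVneq => [ij|]; case: eqVneq => [kj|]; rewrite ?mulr0 //.
      by move: ik; rewrite -val_eqE/= ij kj eqxx.
    rewrite !mulr1n -!val_eqE/= andbb ltnS.
    by case: ltngtP; rewrite ?mulr0 ?mulr1 ?mul0r ?mul1r ?addr0 ?add0r.
  apply: leq_trans (mxrank_add _ _) _; rewrite -addn1 leq_add2l.
  by rewrite (leq_trans (mxrank_scale _ _))// mxrank_delta.
have exB : exists j, (d <= \rank (B j))%N by exists n; rewrite Bn.
have [j dj jmin] := ex_minnP exB.
have jn : (j <= n)%N by apply: jmin; rewrite Bn.
have rB : \rank (B j) = d.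
  apply/eqP; rewrite eqn_leq dj andbT; case: j dj jn jmin => [|j] dj jn jmin.
    by rewrite B0.
  rewrite (leq_trans (BS _ jn))// ltnNge; apply/negP => /jmin.
  by rewrite ltnn.
pose e : 'rV[F]_n := \row_i (((i < j)%N * m).+1%:R)^-1.
exists (diag_mx e *m B j); split.
- suff /eqmxMfull -> : row_full (diag_mx e) by [].
  rewrite row_full_unit unitmxE det_diag unitfE.
  by apply/prodf_neq0 => i _; rewrite mxE invr_eq0 natF_eq0.
- move=> i; rewrite mul_diag_mx !mxE eqxx A1 mulr1n -natrM -natr1 addrC.
  by rewrite mulVf // natr1 natF_eq0.
- apply: le_offmx => i k ik; rewrite mul_diag_mx !mxE (negbTE ik) mulr0n addr0.
  rewrite absM ler_piMl //; set c := _.+1.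
  have : absF c%:R^-1 * absF c%:R = 1 by rewrite -absM mulVf ?abs1 ?natF_eq0.
  rewrite abs_nat => cc; rewrite -cc ler_peMr // ler1n //.
Qed.

Lemma rank_le_minors n d (A : 'M[F]_n) : (\rank A <= d)%N <->
  forall (P : 'M[F]_(d.+1, n)) (Q : 'M[F]_(n, d.+1)), \det (P *m A *m Q) = 0.
Proof.
split=> [rA P Q|H].
  apply/eqP; rewrite -[_ == 0]negbK -unitfE -unitmxE; apply/negP => /mxrank_unit.
  have := leq_trans (mxrankM_maxl (P *m A) Q) (mxrankM_maxr P A).
  by move=> + E; rewrite E => /leq_trans/(_ rA); rewrite ltnn.
rewrite leqNgt; apply/negP => dA.
have dn : (d < n)%N by apply: leq_trans dA (rank_leq_row A).
have := H (pid_mx d.+1 *m invmx (col_ebase A)) (invmx (row_ebase A) *m pid_mx d.+1).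
rewrite -{2}(mulmx_ebase A) !mulmxA mulmxKV ?col_ebase_unit// -!mulmxA.
rewrite mulKVmx ?row_ebase_unit// !mulmxA.
rewrite !mul_pid_mx (minn_idPl dA) (minn_idPr dn) minnn (minn_idPr dn) pid_mx_1 det1.
by move/eqP; rewrite oner_eq0.
Qed.

Section Continuity.
Variable T : topologicalType.

Let cont (f : T -> F) :=
  forall t0, (fun t => absF (f t - f t0)) @ t0 --> (0 : R).

Let cont_abs f : cont f -> continuous (fun t => absF (f t)).
Proof.
move=> cf t0; apply/cvgrPdist_le => e e0.
have /cvgrPdist_le/(_ _ e0) := cf t0.
apply: filterS => t; rewrite sub0r normrN ger0_norm // => h.
rewrite ler_norml; apply/andP; split.
- by have := absD (f t - f t0) (f t0); rewrite subrK; lra.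
- have := absD (f t0 - f t) (f t); rewrite subrK -opprB absN; lra.
Qed.

Let cont_cst c : cont (fun=> c).
Proof. by move=> t0; under eq_fun do rewrite subrr abs0; exact: cvg_cst. Qed.

Let contD f g : cont f -> cont g -> cont (fun t => f t + g t).
Proof.
move=> cf cg t0; apply: (@squeeze_cvgr _ _ _ _ (cst 0)
  (fun t => absF (f t - f t0) + absF (g t - g t0))).
- near=> t; rewrite abs_ge0 /=.
  by rewrite (_ : _ - _ = (f t - f t0) + (g t - g t0)) ?absD // addrACA opprD.
- exact: cvg_cst.
- by rewrite -[X in _ --> X](addr0 0); apply: cvgD; [exact: cf|exact: cg].
Unshelve. all: by end_near. Qed.

Let contM f g : cont f -> cont g -> cont (fun t => f t * g t).
Proof.
move=> cf cg t0; apply: (@squeeze_cvgr _ _ _ _ (cst 0)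
  (fun t => absF (f t) * absF (g t - g t0) + absF (f t - f t0) * absF (g t0))).
- near=> t; rewrite abs_ge0 /= -!absM.
  rewrite (_ : _ - _ = f t * (g t - g t0) + (f t - f t0) * g t0) ?absD //.
  by rewrite mulrBr mulrBl addrA subrK.
- exact: cvg_cst.
- rewrite [X in _ --> X](_ : 0 = absF (f t0) * 0 + 0 * absF (g t0)); last first.
    by rewrite mulr0 mul0r addr0.
  apply: cvgD; apply: cvgM; [exact: cont_abs|exact: cg|exact: cf|exact: cvg_cst].
Unshelve. all: by end_near. Qed.

Let cont_sum I (r : seq I) (P : pred I) (f : I -> T -> F) :
  (forall i, P i -> cont (f i)) -> cont (fun t => \sum_(i <- r | P i) f i t).
Proof.
move=> cf; elim: r => [|i r IH].
  by under eq_fun do rewrite big_nil; exact: cont_cst.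
under eq_fun do rewrite big_cons; case Pi: (P i) => //.
by apply: contD => //; exact: cf.
Qed.

Let cont_prod I (r : seq I) (P : pred I) (f : I -> T -> F) :
  (forall i, P i -> cont (f i)) -> cont (fun t => \prod_(i <- r | P i) f i t).
Proof.
move=> cf; elim: r => [|i r IH].
  by under eq_fun do rewrite big_nil; exact: cont_cst.
under eq_fun do rewrite big_cons; case Pi: (P i) => //.
by apply: contM => //; exact: cf.
Qed.

Let cont_mulmx m n p (A : T -> 'M[F]_(m, n)) (B : T -> 'M[F]_(n, p)) :
  (forall i j, cont (fun t => A t i j)) -> (forall i j, cont (fun t => B t i j)) ->
  forall i j, cont (fun t => (A t *m B t) i j).
Proof.
move=> cA cB i j; under eq_fun do rewrite mxE.
by apply: cont_sum => k _; exact: contM.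
Qed.

Let cont_det n (A : T -> 'M[F]_n) :
  (forall i j, cont (fun t => A t i j)) -> cont (fun t => \det (A t)).
Proof.
move=> cA; apply: cont_sum => s _; apply: contM; first exact: cont_cst.
exact: cont_prod.
Qed.

Let cont_closed0 f : cont f -> closed [set t | f t = 0].
Proof.
move=> cf; have -> : [set t | f t = 0] = (fun t => absF (f t)) @^-1` [set 0].
  by apply/seteqP; split=> t /= => [->//|/abs0_eq0].
by apply: (continuous_closedP _).1 (@closed_eq _ _); exact: cont_abs.
Qed.

Variables (n d : nat) (K : set T) (M : T -> 'M[F]_n).
Hypothesis cK : compact K.
Hypothesis cM : forall i j, cont (fun t => M t i j).
Hypothesis surjM : forall A : 'M[F]_n,
  (forall i j, absF (A i j) <= 1) -> exists2 t, K t & M t = A.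

Lemma off_attained : (0 < d <= n)%N ->
  exists A : 'M[F]_n, [/\ \rank A = d, forall i, A i i = 1 &
    forall B : 'M[F]_n, \rank B = d -> (forall i, B i i = 1) ->
      offmx absF A <= offmx absF B].
Proof.
move=> /andP[d0 dn].
pose S := [set t | [/\ K t, (\rank (M t) <= d)%N & forall i, M t i i = 1]].
have cS : compact S.
  have -> : S = K `&` ((\bigcap_(PQ in [set: 'M[F]_(d.+1, n) * 'M[F]_(n, d.+1)])
      [set t | \det (PQ.1 *m M t *m PQ.2) = 0]) `&`
      (\bigcap_(i in [set: 'I_n]) [set t | M t i i - 1 = 0])).
    apply/seteqP; split=> t /=.
      move=> [Kt rk dg]; split=> //; split => [[P Q] _|i _] /=.
        exact: (rank_le_minors d (M t)).1 rk P Q.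
      by rewrite dg subrr.
    move=> [Kt [rk dg]]; split=> //.
      by apply/rank_le_minors => P Q; exact: (rk (P, Q)).
    by move=> i; apply/eqP; rewrite -subr_eq0; apply/eqP; exact: dg.
  apply: compact_closedI => //; apply: closedI; apply: closed_bigI.
    move=> [P Q] _; apply/cont_closed0/cont_det; do 2?apply: cont_mulmx => //;
    by move=> i j; exact: cont_cst.
  by move=> i _; apply/cont_closed0/contD => //; exact: cont_cst.
have [t1 Kt1 M1] : exists2 t, K t & M t = const_mx 1.
  by apply: surjM => i j; rewrite mxE abs1.
have S1 : S t1.
  split=> // [|i]; rewrite M1 ?mxE//.
  have -> : const_mx 1 = (const_mx 1 : 'cV[F]_n) *m (const_mx 1 : 'rV_n).
    by apply/matrixP => i j; rewrite !mxE big_ord1 !mxE mulr1.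
  exact: leq_trans (mulmx_max_rank _ _) _.
have cO : continuous (fun t => offmx absF (M t)).
  rewrite /offmx; elim: (index_enum _) => [|p r IH] t.
    by under eq_fun do rewrite big_nil; exact: cvg_cst.
  under eq_fun do rewrite big_cons; case: (p.1 != p.2); last exact: IH.
  by apply: continuous_max; [exact: cont_abs|exact: IH].
have cOS : {within S, continuous (fun t => offmx absF (M t))}.
  exact: continuous_subspaceT.
have S0 : S !=set0 by exists t1.
have [t0 /set_mem[Kt0 rk0 dg0] min0] := compact_EVT_min S0 cS cOS.
have [A [rA A1 offA]] : exists A : 'M[F]_n,
    [/\ \rank A = d, forall i, A i i = 1 & offmx absF A <= offmx absF (M t0)].
  by apply: raise_rank; rewrite ?rk0.
exists A; split=> // B rB B1; apply: le_trans offA _.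
have [B_le1|/ltW B_ge1] := leP (offmx absF B) 1.
  have [t Kt Mt] : exists2 t, K t & M t = B.
    apply: surjM => i j; have [->|ij] := eqVneq i j; first by rewrite B1 abs1.
    exact: (offmx_le B ler01).1 B_le1 i j ij.
  by rewrite -Mt; apply: min0; apply/mem_set; split; rewrite ?Mt ?rB.
apply: le_trans B_ge1; apply: le_trans (min0 _ (mem_set S1)) _.
by apply/offmx_le => // i j _; rewrite M1 mxE abs1.
Qed.

End Continuity.
End Minimum.

Lemma is_min_inf (R : realType) (S : set R) m :
  S m -> lbound S m -> S (inf S) /\ lbound S (inf S).
Proof.
move=> Sm mS; suff -> : inf S = m by [].
apply/eqP; rewrite eq_le lb_le_inf ?andbT //; last by exists m.
by apply: ge_inf => //; exists m.
Qed.

Lemma unit_box_compact (R : realType) n :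
  compact [set v : 'rV[R]_n | forall i, v ord0 i \in `[-1, 1]].
Proof.
have H : forall i : 'I_n, compact (`[-1, 1]%classic : set R).
  by move=> _; exact: segment_compact.
refine (rV_compact H).
Qed.

Lemma coord_dist_cvg0 (R : realType) n (t0 : 'rV[R]_n) s :
  (fun t : 'rV[R]_n => `|t ord0 s - t0 ord0 s|) @ t0 --> (0 : R).
Proof.
have FF : Filter (nbhs t0) by exact: nbhs_filter.
apply/(@cvgrPdist_le _ _ _ _ FF) => e e0.
have /(@cvgrPdist_le _ _ _ _ FF)/(_ _ e0) := @coord_continuous R 1 n ord0 s t0.
by apply: filterS => t; rewrite sub0r normrN normr_id distrC.
Qed.

Section Attained.
Variables (R : realType) (d k : nat).
Hypothesis d0 : (0 < d)%N.

Let N := (d + k)%N.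
Let K := [set v : 'rV[R]_(N * N) | forall i, v ord0 i \in `[-1, 1]].
Let cK : compact K.
Proof.
exact: unit_box_compact.
Qed.
Let inK (A : 'M[R]_N) : (forall i j, `|A i j| <= 1) -> K (mxvec A).
Proof.
by move=> A1 s /=; case/mxvec_indexP: s => i j; rewrite mxvecE in_itv/= -ler_norml.
Qed.

Lemma offR_min :
  let S := [set offmx (fun x : R => `|x|) A | A in @admissible R d k] in
  S (offR R d k) /\ lbound S (offR R d k).
Proof.
move=> S.
have [|||||i j t0|A A1||A [rA A1 minA]] :=
  @off_attained R R (fun x : R => `|x|) _ _ _ _ _ _ N d K (fun v => vec_mx v) cK.
- exact: normrM.
- exact: ler_normD.
- exact: normrN.
- by move=> n; rewrite normr_nat.
- by move=> x /normr0_eq0.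
- rewrite /= (_ : (fun t => _) = (fun t : 'rV[R]_(N * N) =>
    `|t ord0 (mxvec_index i j) - t0 ord0 (mxvec_index i j)|)); last first.
    by apply/funext => t; rewrite !mxE.
  exact: coord_dist_cvg0.
- by exists (mxvec A); [exact: inK | rewrite mxvecK].
- by rewrite d0 leq_addr.
- have SA : S (offmx (fun x : R => `|x|) A) by exists A.
  have lA : lbound S (offmx (fun x : R => `|x|) A).
    by move=> _ [B [rB B1] <-]; exact: minA.
  exact: is_min_inf SA lA.
Qed.

Let normc_ge0 (z : R[i]) : 0 <= Normc.normc z.
Proof. by case: z => a b; exact: sqrtr_ge0. Qed.
Let normC (z : R[i]) : `|z| = (Normc.normc z)%:C%C.
Proof. by rewrite normc_def; case: z. Qed.
Let normc_le (z : R[i]) : Normc.normc z <= `|complex.Re z| + `|complex.Im z|.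
Proof.
case: z => a b /=; rewrite -(ger0_norm (addr_ge0 (normr_ge0 a) (normr_ge0 b))).
rewrite -sqrtr_sqr ler_wsqrtr// sqrrD !real_normK ?num_real//.
by rewrite addrAC lerDl mulrn_wge0// mulr_ge0.
Qed.
Let Re_le (z : R[i]) : `|complex.Re z| <= Normc.normc z.
Proof. by case: z => a b /=; rewrite -sqrtr_sqr ler_wsqrtr// lerDl sqr_ge0. Qed.
Let Im_le (z : R[i]) : `|complex.Im z| <= Normc.normc z.
Proof. by case: z => a b /=; rewrite -sqrtr_sqr ler_wsqrtr// lerDr sqr_ge0. Qed.

Lemma offC_min :
  let S := [set offmx (@Normc.normc R) A | A in @admissible R[i] d k] in
  S (offC R d k) /\ lbound S (offC R d k).
Proof.
move=> S.
pose M (t : 'rV[R]_(N * N) * 'rV[R]_(N * N)) : 'M[R[i]]_N :=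
  \matrix_(i, j) (vec_mx t.1 i j +i* vec_mx t.2 i j)%C.
have [|||||i j t0|A A1||A [rA A1 minA]] :=
  @off_attained R R[i] (@Normc.normc R) _ _ _ _ _ _ N d _ M (compact_setX cK cK).
- exact: Normc.normcM.
- exact: le_normcD.
- exact: normcN.
- by move=> n; apply: (@complexI R); rewrite -normC normr_nat rmorph_nat.
- exact: Normc.eq0_normc.
- have FF : Filter (nbhs t0) by exact: nbhs_filter.
  apply: (@squeeze_cvgr _ (nbhs t0) FF R (cst 0) (fun t =>
    `|t.1 ord0 (mxvec_index i j) - t0.1 ord0 (mxvec_index i j)|
    + `|t.2 ord0 (mxvec_index i j) - t0.2 ord0 (mxvec_index i j)|)).
  + near=> t; rewrite normc_ge0/=; apply: le_trans (normc_le _) _.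
    by rewrite !mxE.
  + exact: cvg_cst.
  + rewrite -[X in _ --> X](addr0 0).
    apply: cvgD.
      exact: (cvg_comp _ _ cvg_fst (@coord_dist_cvg0 _ _ t0.1 _)).
    exact: (cvg_comp _ _ cvg_snd (@coord_dist_cvg0 _ _ t0.2 _)).
- exists (mxvec (map_mx (@complex.Re R) A), mxvec (map_mx (@complex.Im R) A)).
    by split; apply: inK => i j; rewrite mxE;
      apply: le_trans (A1 i j); [exact: Re_le|exact: Im_le].
  by apply/matrixP => i j; rewrite /M mxE /= !mxvecK !mxE; case: (A i j).
- by rewrite d0 leq_addr.
- have SA : S (offmx (@Normc.normc R) A) by exists A.
  have lA : lbound S (offmx (@Normc.normc R) A).
    by move=> _ [B [rB B1] <-]; exact: minA.
  exact: is_min_inf SA lA.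
Unshelve. all: by end_near. Qed.

End Attained.

(* Main.v *)
(* Let A have rank d and unit diagonal, n = d + k, and let the vectors u_i in
   F^k form a Parseval frame with Gram matrix P satisfying A P = 0. The trace
   of A P gives k <= off(A) (sum |P_ij| - k), so everything rests on the bound
   sum |P_ij| <= k alpha n, for which norms r_i = |u_i| and cosines t_ij are
   separated. With b the angle of the extremal systems, the quartic majorant
     2 b (1 + b)^2 t <= b^2 (1 + 2 b) + (1 + 2 b + 3 b^2) t^2 - t^4,
   with equality on [0, 1] only at t = b and t = 1, is summed with the weights
   r_i r_j. The quadratic term is at most n by AM-GM, since
   sum_j |P_ij|^2 = r_i^2, the quartic term is bounded below by projecting
   sum r_i (u_i / r_i)^{(x) 4} on an invariant tensor, and (sum r_i)^2 <= k n.
   In the equality case all r_i agree and all t_ij are 1 or b; counting with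
   sum_j t_ij^2 = n / k shows that every line is repeated n / N times. *)

Require Import Defs.
From HB Require Import structures.
From mathcomp Require Import all_boot all_order all_algebra.
From mathcomp Require Import complex.
From mathcomp Require Import all_classical all_reals all_analysis.
From mathcomp Require Import ring lra.

Import Order.TTheory GRing.Theory Num.Theory.

Local Open Scope classical_set_scope.
Local Open Scope card_scope.
Local Open Scope ring_scope.

(** * Sums of Gram entries of a Parseval frame *)

Section RealInequality.
Set Implicit Arguments.
Unset Strict Implicit.
Variable R : realType.

(** Lagrange's identity against the all-ones vector: the defect in (sum r_i)^2 <= k n becomes a sum
    of squares. *)
Lemma sum_sqr_diff n (r : 'I_n -> R) :
  \sum_i \sum_j (r i - r j) ^+ 2 = 2 * (n%:R * (\sum_i r i ^+ 2) - (\sum_i r i) ^+ 2).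
Proof.
transitivity (\sum_i (n%:R * r i ^+ 2 - 2 * (r i * \sum_j r j) + \sum_j r j ^+ 2)).
  apply: eq_bigr => i _.
  under eq_bigr do rewrite sqrrB.
  rewrite big_split/= sumrB sumr_const card_ord; congr (_ - _ + _).
    by rewrite mulr_natl.
  by rewrite !mulr_sumr; apply: eq_bigr => j _; rewrite mulr_natl.
rewrite big_split/= sumrB -!mulr_sumr sumr_const card_ord -mulr_suml -mulr_natl.
ring.
Qed.

(* The difference of the two sides is [(t - b)^2 (1 - t) (t + 1 + 2 b)]. *)
Lemma quartic_majorant (b t : R) : 0 < b -> 0 <= t <= 1 ->
  let e := b ^+ 2 * (1 + 2 * b) + (1 + 2 * b + 3 * b ^+ 2) * t ^+ 2 - t ^+ 4
           - 2 * b * (1 + b) ^+ 2 * t in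
  0 <= e /\ (e = 0 -> t = 1 \/ t = b).
Proof.
move=> b0 /andP[t0 t1] e.
have -> : e = (t - b) ^+ 2 * (1 - t) * (t + 1 + 2 * b) by rewrite /e; ring.
clear e; split; first by do 2?apply: mulr_ge0; rewrite ?sqr_ge0//; lra.
move=> /eqP; rewrite !mulf_eq0 orbb => /orP[/orP[/eqP h|/eqP h]|/eqP h];
  [right|left|left]; lra.
Qed.

(** Here [g i j] stands for |<u_i, u_j>| and [r i] for |u_i|. The constant [q] belongs to the
    invariant tensor: 2 in the unitary case, 3 in the orthogonal one. *)
Variables (n : nat) (g : 'I_n -> 'I_n -> R) (r : 'I_n -> R) (k q b : R).
Hypotheses (k0 : 0 < k) (b0 : 0 < b) (hb : b ^+ 2 * (k + q - 1) = 1).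
Hypothesis hq : q < k * (1 + 2 * b).
Hypotheses (r_ge0 : forall i, 0 <= r i) (g_ge0 : forall i j, 0 <= g i j).
Hypothesis g_sym : forall i j, g i j = g j i.
Hypothesis g_le : forall i j, g i j <= r i * r j.
Hypothesis g_row : forall i, \sum_j g i j ^+ 2 = r i ^+ 2.
Hypothesis r_tr : \sum_i r i ^+ 2 = k.
Hypothesis g_quartic :
  q * (\sum_i r i) ^+ 2 <=
  k * (k + q - 1) * \sum_i \sum_j (r i)^-1 ^+ 3 * (r j)^-1 ^+ 3 * g i j ^+ 4.

(** The quartic majorant at t = g_ij / (r_i r_j), multiplied by r_i r_j. *)
Let slack i j := b ^+ 2 * (1 + 2 * b) * (r i * r j)
  + (1 + 2 * b + 3 * b ^+ 2) * ((r i)^-1 * (r j)^-1 * g i j ^+ 2)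
  - (r i)^-1 ^+ 3 * (r j)^-1 ^+ 3 * g i j ^+ 4 - 2 * b * (1 + b) ^+ 2 * g i j.

Let g_eq0 i j : r i * r j = 0 -> g i j = 0.
Proof. by move=> h; apply/eqP; rewrite eq_le g_ge0 andbT -h g_le. Qed.

Let slackP i j : 0 <= slack i j /\
  (slack i j = 0 -> g i j = r i * r j \/ g i j = b * (r i * r j)).
Proof.
(* If a norm vanishes, so does [g i j] by [g_le]; every term of [slack] is then 0 and the first
   alternative reads 0 = 0. *)
have [h|h] := eqVneq (r i * r j) 0.
  rewrite /slack (g_eq0 h) h !expr0n/= !mulr0 !subr0 addr0 lexx; split => //.
  by left.
have [ri rj] : r i != 0 /\ r j != 0.
  by move: h; rewrite mulf_eq0 negb_or => /andP[].
have p0 : 0 < r i * r j by rewrite lt_def h mulr_ge0.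
have [|e0 eE] := @quartic_majorant b (g i j / (r i * r j)) b0.
  by rewrite divr_ge0 ?(ltW p0)//= ler_pdivrMr// mul1r.
pose t := g i j / (r i * r j).
have gE : g i j = t * (r i * r j) by rewrite /t mulfVK.
have -> : slack i j = r i * r j * (b ^+ 2 * (1 + 2 * b)
    + (1 + 2 * b + 3 * b ^+ 2) * t ^+ 2 - t ^+ 4 - 2 * b * (1 + b) ^+ 2 * t).
  by rewrite /slack gE; field; rewrite ri rj.
split; first by rewrite mulr_ge0 ?(ltW p0).
move=> /eqP; rewrite mulf_eq0 (negbTE h)/= => /eqP /eE.
by rewrite -/t gE => -[]->; [left; rewrite mul1r|right].
Qed.

(* AM-GM against the row sums: [sum_j g_ij^2 = r_i^2]. *)
Let middle_le : \sum_i \sum_j (r i)^-1 * (r j)^-1 * g i j ^+ 2 <= n%:R.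
Proof.
have S1 : \sum_i \sum_j (r i)^-1 ^+ 2 * g i j ^+ 2 <= n%:R.
  rewrite -[X in _ <= X%:R]card_ord -sumr_const; apply: ler_sum => i _.
  (* A zero vector contributes 0 instead of 1, because [0^-1 = 0]; hence an inequality. *)
  rewrite -mulr_sumr g_row -exprMn; have [->|h] := eqVneq (r i) 0.
    by rewrite mulr0 expr0n/= ler01.
  by rewrite mulVf// expr1n.
have S2 : \sum_i \sum_j (r j)^-1 ^+ 2 * g i j ^+ 2 <= n%:R.
  rewrite exchange_big/=; apply: le_trans S1.
  by apply: ler_sum => i _; apply: ler_sum => j _; rewrite g_sym.
have : 2 * (\sum_i \sum_j (r i)^-1 * (r j)^-1 * g i j ^+ 2) <=
    \sum_i \sum_j (r i)^-1 ^+ 2 * g i j ^+ 2 + \sum_i \sum_j (r j)^-1 ^+ 2 * g i j ^+ 2.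
  rewrite mulr_sumr -big_split/=; apply: ler_sum => i _.
  rewrite mulr_sumr -big_split/=; apply: ler_sum => j _.
  rewrite -subr_ge0 (_ : _ - _ = ((r i)^-1 - (r j)^-1) ^+ 2 * g i j ^+ 2).
    by rewrite mulr_ge0 ?sqr_ge0.
  ring.
lra.
Qed.

(** The right-hand side of [E_def] divided by n, at the extremal values W^2 = k n, T = n, Q = q b^2
    n and E = 0. *)
Let L := k * b ^+ 2 * (1 + 2 * b) - q * b ^+ 2 + (1 + 2 * b + 3 * b ^+ 2).
Let W := \sum_i r i.
Let T := \sum_i \sum_j (r i)^-1 * (r j)^-1 * g i j ^+ 2.
Let Q := \sum_i \sum_j (r i)^-1 ^+ 3 * (r j)^-1 ^+ 3 * g i j ^+ 4.
Let E := \sum_i \sum_j slack i j.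

Let E_def : 2 * b * (1 + b) ^+ 2 * (\sum_i \sum_j g i j) =
  b ^+ 2 * (1 + 2 * b) * W ^+ 2 + (1 + 2 * b + 3 * b ^+ 2) * T - Q - E.
Proof.
have -> : W ^+ 2 = \sum_i \sum_j r i * r j.
  by rewrite expr2 /W mulr_suml; apply: eq_bigr => i _; rewrite mulr_sumr.
suff -> : E = b ^+ 2 * (1 + 2 * b) * (\sum_i \sum_j r i * r j)
  + (1 + 2 * b + 3 * b ^+ 2) * T - Q - 2 * b * (1 + b) ^+ 2 * (\sum_i \sum_j g i j).
  ring.
rewrite /T /Q !mulr_sumr -big_split -!sumrB; apply: eq_bigr => i _.
by rewrite !mulr_sumr -big_split -!sumrB.
Qed.

Let W_le : 0 <= k * n%:R - W ^+ 2 /\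
  (k * n%:R - W ^+ 2 = 0 -> forall i, r i ^+ 2 * n%:R = k).
Proof.
have := sum_sqr_diff r; rewrite r_tr -/W => D.
have S0 i : 0 <= \sum_j (r i - r j) ^+ 2 by apply: sumr_ge0 => j _; exact: sqr_ge0.
have S : 0 <= \sum_i \sum_j (r i - r j) ^+ 2 by apply: sumr_ge0 => i _.
split=> [|h]; first by lra.
have /eqP : \sum_i \sum_j (r i - r j) ^+ 2 = 0 by rewrite D mulrC [n%:R * _]mulrC h mul0r.
rewrite psumr_eq0// => /allP H i.
have /eqP/eqP := H i (mem_index_enum i); rewrite psumr_eq0; last first.
  by move=> j _; exact: sqr_ge0.
move=> /allP H'; rewrite mulr_natr -[X in _ *+ X]card_ord -sumr_const -r_tr.
apply: eq_bigr => j _; have := H' j (mem_index_enum j).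
by rewrite /= expf_eq0/= subr_eq0 => /eqP->.
Qed.

(** The gap splits into four non-negative defects: unequal norms, AM-GM, tensor projection, quartic
    majorant. The sign of the first coefficient is [hq]. *)
Let decomposition :
  k * (L * n%:R - 2 * b * (1 + b) ^+ 2 * (\sum_i \sum_j g i j)) =
  b ^+ 2 * (k * (1 + 2 * b) - q) * (k * n%:R - W ^+ 2)
  + k * (1 + 2 * b + 3 * b ^+ 2) * (n%:R - T) + (k * Q - q * b ^+ 2 * W ^+ 2) + k * E.
Proof. rewrite E_def /L; ring. Qed.

Let Q_ge : 0 <= k * Q - q * b ^+ 2 * W ^+ 2.
Proof.
have := ler_wpM2l (sqr_ge0 b) g_quartic; rewrite -/W -/Q.
have -> : b ^+ 2 * (k * (k + q - 1) * Q) = (b ^+ 2 * (k + q - 1)) * (k * Q) by ring.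
rewrite hb; lra.
Qed.

Let E_ge0 : 0 <= E.
Proof. by apply: sumr_ge0 => i _; apply: sumr_ge0 => j _; case: (slackP i j). Qed.

Let main_ge0 : 0 <= b ^+ 2 * (k * (1 + 2 * b) - q) * (k * n%:R - W ^+ 2).
Proof.
apply: mulr_ge0; last by case: W_le.
by rewrite mulr_ge0 ?sqr_ge0 ?subr_ge0 ?(ltW hq).
Qed.

Let mid_ge0 : 0 <= k * (1 + 2 * b + 3 * b ^+ 2) * (n%:R - T).
Proof.
apply: mulr_ge0; last by rewrite subr_ge0 middle_le.
by rewrite mulr_ge0 ?(ltW k0)//; have := sqr_ge0 b; move: b0; lra.
Qed.

Lemma frame_sum_le : 2 * b * (1 + b) ^+ 2 * (\sum_i \sum_j g i j) <= L * n%:R.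
Proof.
rewrite -subr_ge0 -(pmulr_rge0 _ k0) decomposition.
have kE : 0 <= k * E by rewrite mulr_ge0 ?E_ge0// ltW.
by rewrite addr_ge0// addr_ge0 ?Q_ge// addr_ge0 ?main_ge0 ?mid_ge0.
Qed.

(** Equality kills each defect. As [hq] is strict, the first gives W^2 = k n and so equal norms; the
    last makes every [slack] vanish. *)
Lemma frame_sum_eq : 2 * b * (1 + b) ^+ 2 * (\sum_i \sum_j g i j) = L * n%:R ->
  (forall i, r i ^+ 2 * n%:R = k) /\
  (forall i j, g i j = r i * r j \/ g i j = b * (r i * r j)).
Proof.
move=> h; have := decomposition; rewrite h subrr mulr0 => D.
have kE : 0 <= k * E by rewrite mulr_ge0 ?E_ge0// ltW.
have /eqP M0 : b ^+ 2 * (k * (1 + 2 * b) - q) * (k * n%:R - W ^+ 2) = 0.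
  by have := main_ge0; have := mid_ge0; have := Q_ge; lra.
have /eqP : k * E = 0.
  by have := main_ge0; have := mid_ge0; have := Q_ge; lra.
rewrite mulf_eq0 gt_eqF//= /E psumr_eq0; last first.
  by move=> i _; apply: sumr_ge0 => j _; case: (slackP i j).
move=> /allP H; split.
  case: W_le => _; apply; apply/eqP.
  by move: M0; rewrite !mulf_eq0 (gt_eqF b0) subr_eq0 (gt_eqF hq).
move=> i j; case: (slackP i j) => _; apply; apply/eqP.
have := H i (mem_index_enum i); rewrite /= psumr_eq0 => [/allP/(_ j (mem_index_enum j))//|l _].
by case: (slackP i l).
Qed.

End RealInequality.

(** * Hermitian forms over the real and the complex numbers *)

Section HermitianField.
Set Implicit Arguments.
Unset Strict Implicit.

Lemma sum_pair (V : nmodType) (I J : finType) (f : I * J -> V) :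
  \sum_p f p = \sum_i \sum_j f (i, j).
Proof. by rewrite pair_bigA; apply: eq_bigr => -[]. Qed.

Lemma sum_delta (K : pzRingType) (I : finType) (f : I -> K) a :
  \sum_i f i * (a == i)%:R = f a.
Proof.
rewrite (bigD1 a)//= eqxx mulr1 big1 ?addr0// => i ia.
by rewrite eq_sym (negbTE ia) mulr0.
Qed.

(** One argument serves both fields: [cj] is the identity or complex conjugation, [emb] the
    inclusion of the reals. Identities for [absF] follow from [mul_cj] by comparing squares. *)
Variables (R : realType) (F : fieldType) (absF : F -> R).
Variables (cj : {rmorphism F -> F}) (emb : {rmorphism R -> F}).
Hypothesis abs_ge0 : forall x, 0 <= absF x.
Hypothesis cjK : involutive cj.
Hypothesis cj_emb : forall x, cj (emb x) = emb x.
Hypothesis mul_cj : forall z, z * cj z = emb (absF z ^+ 2).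

Let embI : injective emb. Proof. exact: fmorph_inj. Qed.

Lemma absF_M x y : absF (x * y) = absF x * absF y.
Proof.
apply/eqP; rewrite -(@eqrXn2 _ 2)// ?mulr_ge0//; apply/eqP/embI.
by rewrite -mul_cj exprMn [RHS]rmorphM -!mul_cj rmorphM mulrACA.
Qed.

Lemma absF_cj x : absF (cj x) = absF x.
Proof.
apply/eqP; rewrite -(@eqrXn2 _ 2)//; apply/eqP/embI.
by rewrite -!mul_cj cjK mulrC.
Qed.

Lemma absF_emb x : 0 <= x -> absF (emb x) = x.
Proof.
move=> x0; apply/eqP; rewrite -(@eqrXn2 _ 2)//; apply/eqP/embI.
by rewrite -mul_cj cj_emb -rmorphM.
Qed.

Lemma absF_eq0 x : absF x = 0 -> x = 0.
Proof.
move=> h; have := mul_cj x; rewrite h expr0n rmorph0 => /eqP.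
by rewrite mulf_eq0 fmorph_eq0 orbb => /eqP.
Qed.

Lemma absF_sum_ge0 (I : finType) (z : I -> F) : 0 <= \sum_i absF (z i) ^+ 2.
Proof. by apply: sumr_ge0 => i _; exact: sqr_ge0. Qed.

Lemma absF_sum_eq0 (I : finType) (z : I -> F) :
  \sum_i absF (z i) ^+ 2 = 0 -> forall i, z i = 0.
Proof.
move=> /eqP; rewrite psumr_eq0 => [/allP h i|i _]; last exact: sqr_ge0.
by have := h i (mem_index_enum i); rewrite /= expf_eq0/= => /eqP/absF_eq0.
Qed.

Lemma mul_cj_sum (I : finType) (z : I -> F) :
  \sum_i z i * cj (z i) = emb (\sum_i absF (z i) ^+ 2).
Proof. by rewrite rmorph_sum; apply: eq_bigr => i _; exact: mul_cj. Qed.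

Definition sqnorm k (x : 'rV[F]_k) : R := \sum_i absF (x 0 i) ^+ 2.

Lemma dotF_sqnorm k (x : 'rV[F]_k) : dotF cj x x = emb (sqnorm x).
Proof. exact: mul_cj_sum. Qed.

Lemma dotF_cj k (x y : 'rV[F]_k) : cj (dotF cj x y) = dotF cj y x.
Proof. by rewrite rmorph_sum; apply: eq_bigr => i _; rewrite rmorphM cjK mulrC. Qed.

(** The vector is |y|^2 times the component of x orthogonal to y, with denominators cleared. It
    yields Cauchy-Schwarz and its equality case. *)
Lemma residual_sqnorm k (x y : 'rV[F]_k) :
  sqnorm (emb (sqnorm y) *: x - dotF cj x y *: y) =
  sqnorm y * (sqnorm y * sqnorm x - absF (dotF cj x y) ^+ 2).
Proof.
apply: embI; rewrite -dotF_sqnorm [RHS]rmorphM [X in _ = _ * X]rmorphB.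
rewrite [X in _ = _ * (X - _)]rmorphM/= -mul_cj -!dotF_sqnorm.
set D := dotF cj y y; set e := dotF cj x y.
have cD : cj D = D by rewrite dotF_cj.
transitivity (\sum_i (D ^+ 2 * (x 0 i * cj (x 0 i)) - D * cj e * (x 0 i * cj (y 0 i))
   - D * e * (y 0 i * cj (x 0 i)) + e * cj e * (y 0 i * cj (y 0 i)))).
  by apply: eq_bigr => i _; rewrite !mxE rmorphB !rmorphM/= cD; ring.
rewrite big_split/= !sumrB -!mulr_sumr -/(dotF cj x x) -/(dotF cj y y) -/(dotF cj x y).
rewrite -/(dotF cj y x) -(dotF_cj x y) -/e -/D; ring.
Qed.

Lemma cauchy_schwarz k (x y : 'rV[F]_k) :
  absF (dotF cj x y) ^+ 2 <= sqnorm x * sqnorm y.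
Proof.
have := absF_sum_ge0 (fun i => (emb (sqnorm y) *: x - dotF cj x y *: y) 0 i).
rewrite -/(sqnorm _) residual_sqnorm.
have [y0|/eqP y0] := eqVneq (sqnorm y) 0.
  rewrite y0 mulr0 /dotF big1 ?mul0r => [|i _].
    by rewrite -(rmorph0 emb) absF_emb// expr0n.
  by rewrite (absF_sum_eq0 y0) rmorph0 mulr0.
rewrite pmulr_rge0 ?subr_ge0 1?mulrC// lt_def; apply/andP; split; first exact/eqP.
exact: absF_sum_ge0.
Qed.

Lemma unit_parallel k (x y : 'rV[F]_k) :
  sqnorm x = 1 -> sqnorm y = 1 -> absF (dotF cj x y) = 1 -> x = dotF cj x y *: y.
Proof.
move=> x1 y1 xy; have := residual_sqnorm x y.
rewrite x1 y1 xy expr1n mulr1 subrr mulr0 rmorph1 scale1r => h.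
apply/rowP => i; apply/eqP; rewrite -subr_eq0; apply/eqP.
by have := absF_sum_eq0 h i; rewrite !mxE.
Qed.

Lemma dotFZl k a (x y : 'rV[F]_k) : dotF cj (a *: x) y = a * dotF cj x y.
Proof. by rewrite /dotF mulr_sumr; apply: eq_bigr => i _; rewrite mxE mulrA. Qed.

Lemma dotFZr k a (x y : 'rV[F]_k) : dotF cj x (a *: y) = cj a * dotF cj x y.
Proof. by rewrite -dotF_cj dotFZl rmorphM dotF_cj. Qed.

(* Expand the squared norm of [sum_j c_j y_j - s G]. *)
Lemma tensor_gap (I J : finType) (y : J -> I -> F) (G : I -> F) (c : J -> R)
    (m : J -> J -> R) (p : J -> R) (v s : R) :
  (forall j l, \sum_x y j x * cj (y l x) = emb (m j l)) ->
  (forall j, \sum_x y j x * cj (G x) = emb (p j)) ->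
  \sum_x G x * cj (G x) = emb v ->
  0 <= \sum_j \sum_l c j * c l * m j l - 2 * s * (\sum_j c j * p j) + s ^+ 2 * v.
Proof.
move=> ym yG GG; pose z x := \sum_j emb (c j) * y j x.
have zz : \sum_x z x * cj (z x) = emb (\sum_j \sum_l c j * c l * m j l).
  rewrite rmorph_sum; under eq_bigr do rewrite /z mulr_suml.
  rewrite exchange_big/=; apply: eq_bigr => j _; rewrite rmorph_sum.
  under eq_bigr do rewrite rmorph_sum mulr_sumr.
  rewrite exchange_big/=; apply: eq_bigr => l _.
  rewrite !rmorphM/= -ym mulr_sumr; apply: eq_bigr => x _.
  by rewrite !rmorphM cj_emb/=; ring.
have zG : \sum_x z x * cj (G x) = emb (\sum_j c j * p j).
  rewrite rmorph_sum; under eq_bigr do rewrite /z mulr_suml.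
  rewrite exchange_big/=; apply: eq_bigr => j _.
  by rewrite rmorphM/= -yG mulr_sumr; apply: eq_bigr => x _; rewrite mulrA.
have Gz : \sum_x G x * cj (z x) = emb (\sum_j c j * p j).
  rewrite -cj_emb -zG rmorph_sum; apply: eq_bigr => x _.
  by rewrite rmorphM cjK mulrC.
suff <- : \sum_x absF (z x - emb s * G x) ^+ 2 =
   \sum_j \sum_l c j * c l * m j l - 2 * s * (\sum_j c j * p j) + s ^+ 2 * v.
  exact: absF_sum_ge0.
apply: embI; rewrite -mul_cj_sum.
rewrite rmorphD rmorphB !rmorphM rmorph_nat -zz/= -GG.
transitivity (\sum_x (z x * cj (z x) - emb s * (z x * cj (G x)) - emb s * (G x * cj (z x))
   + emb s ^+ 2 * (G x * cj (G x)))).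
  by apply: eq_bigr => x _; rewrite rmorphB rmorphM cj_emb/=; ring.
by rewrite big_split/= !sumrB -!mulr_sumr zG Gz; ring.
Qed.

(** * Fourth moments and the invariant tensor *)

Section Quartic.
Variable (k : nat) (eps : bool).
Hypothesis cj_id : eps -> forall x, cj x = x.
Let I := (('I_k * 'I_k) * ('I_k * 'I_k))%type.
Let q : R := 2 + eps%:R.

(* The sum of the pairings of four indices that are invariant under the
   unitary group ([eps = false]) or the orthogonal group ([eps = true]); a
   quadruple [((a, c), (b, d))] carries conjugates in the positions [c], [d]. *)
Let G (x : I) : F :=
  (x.1.1 == x.1.2)%:R * (x.2.1 == x.2.2)%:R
  + (x.1.2 == x.2.1)%:R * (x.1.1 == x.2.2)%:R
  + eps%:R * ((x.1.1 == x.2.1)%:R * (x.1.2 == x.2.2)%:R).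

Let cjG x : cj (G x) = G x.
Proof. by rewrite /G !rmorphD !rmorphM !rmorph_nat. Qed.

Let sum_G (z : I -> F) : \sum_x z x * G x =
  \sum_a \sum_b (z ((a, a), (b, b)) + z ((a, b), (b, a)) + eps%:R * z ((a, b), (a, b))).
Proof.
under [RHS]eq_bigr do rewrite !big_split/=.
rewrite [RHS]big_split/= [X in _ = X + _]big_split/=.
under [LHS]eq_bigr do rewrite /G !mulrDr.
rewrite !big_split/=; congr (_ + _ + _); rewrite !sum_pair.
- apply: eq_bigr => a _.
  rewrite -[RHS](sum_delta (fun c => \sum_b z ((a, c), (b, b)))).
  apply: eq_bigr => c _; rewrite sum_pair mulr_suml; apply: eq_bigr => b _.
  rewrite -[RHS](sum_delta (fun d => z ((a, c), (b, d)) * (a == c)%:R)).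
  by apply: eq_bigr => d _; rewrite mulrA.
- apply: eq_bigr => a _; apply: eq_bigr => c _; rewrite sum_pair.
  rewrite -[RHS](sum_delta (fun b => z ((a, c), (b, a)))).
  apply: eq_bigr => b _.
  rewrite -[RHS](sum_delta (fun d => z ((a, c), (b, d)) * (c == b)%:R)).
  by apply: eq_bigr => d _; rewrite mulrA.
- apply: eq_bigr => a _; apply: eq_bigr => c _; rewrite sum_pair.
  rewrite -[RHS](sum_delta (fun b => eps%:R * z ((a, c), (b, c)))).
  apply: eq_bigr => b _.
  rewrite -[RHS](sum_delta (fun d => eps%:R * z ((a, c), (b, d)) * (a == b)%:R)).
  by apply: eq_bigr => d _; rewrite mulrCA !mulrA.
Qed.

Let GG : \sum_x G x * cj (G x) = emb (k%:R * (k%:R + q - 1) * q).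
Proof.
under eq_bigr do rewrite cjG.
rewrite sum_G /G /=.
transitivity (\sum_(a < k) (k%:R * (2 + eps%:R) + (2 + 4 * eps%:R) : F)).
  apply: eq_bigr => a _.
  (* For a != b each of the 2 + eps pairings meets only itself; for a = b all coincide, which adds
     (2 + eps)^2 - (2 + eps) = 2 + 4 eps. *)
  transitivity (\sum_(b < k) ((2 + eps%:R : F) + (2 + 4 * eps%:R) * (a == b)%:R)).
    apply: eq_bigr => b _; rewrite !eqxx [b == a]eq_sym.
    by case: (a == b); case: eps; rewrite /=; ring.
  by rewrite big_split/= sum_delta sumr_const card_ord -[X in X + _]mulr_natl.
rewrite sumr_const card_ord -[LHS]mulr_natl /q.
by rewrite !rmorphM !rmorphB !rmorphD !rmorph_nat; case: eps; rewrite /=; ring.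
Qed.

Variables (n : nat) (u : 'I_n -> 'rV[F]_k) (r : 'I_n -> R).
Hypothesis r_sqnorm : forall i, r i ^+ 2 = sqnorm (u i).
(** The fourth tensor power of [u i], with conjugates in two positions so that phases cancel. *)
Let y i (x : I) : F :=
  u i 0 x.1.1 * cj (u i 0 x.1.2) * (u i 0 x.2.1 * cj (u i 0 x.2.2)).

Let yy i j : \sum_x y i x * cj (y j x) = emb (absF (dotF cj (u i) (u j)) ^+ 4).
Proof.
have S : \sum_(p : 'I_k * 'I_k) (u i 0 p.1 * cj (u i 0 p.2)) * cj (u j 0 p.1 * cj (u j 0 p.2))
    = emb (absF (dotF cj (u i) (u j)) ^+ 2).
  rewrite sum_pair -mul_cj dotF_cj /dotF mulr_suml; apply: eq_bigr => a _.
  rewrite mulr_sumr; apply: eq_bigr => b _; rewrite /= rmorphM cjK; ring.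
rewrite (exprM _ 2 2) rmorphXn/= -S expr2 mulr_suml sum_pair; apply: eq_bigr => p _.
by rewrite mulr_sumr; apply: eq_bigr => p' _; rewrite /y/= !rmorphM; ring.
Qed.

Let yG i : \sum_x y i x * cj (G x) = emb (q * r i ^+ 4).
Proof.
under eq_bigr do rewrite cjG.
have uu : \sum_a \sum_b u i 0 a * cj (u i 0 a) * (u i 0 b * cj (u i 0 b)) = emb (r i ^+ 4).
  under eq_bigr do rewrite -mulr_sumr.
  by rewrite -mulr_suml mul_cj_sum -rmorphM/= -/(sqnorm (u i)) -r_sqnorm -exprD.
rewrite sum_G rmorphM/= rmorphD !rmorph_nat -uu mulr_sumr; apply: eq_bigr => a _.
rewrite mulr_sumr; apply: eq_bigr => b _; rewrite /y/=.
(* The third pairing gives the sum of u_a^2 conj(u_b)^2, which is |u|^4 once conjugation is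
   trivial. *)
by case: eps cj_id => [/(_ isT) id|_] /=; rewrite ?id; ring.
Qed.

Lemma quartic_moment : (0 < k)%N ->
  q * (\sum_i r i) ^+ 2 <= k%:R * (k%:R + q - 1) *
    \sum_i \sum_j (r i)^-1 ^+ 3 * (r j)^-1 ^+ 3 * absF (dotF cj (u i) (u j)) ^+ 4.
Proof.
move=> k0; set M := (X in _ <= _ * X); set W := \sum_i r i.
have k1 : 1 <= k%:R :> R by rewrite ler1n.
have q2 : 2 <= q by rewrite /q lerDl.
have K0 : 0 < k%:R * (k%:R + q - 1) by apply: mulr_gt0; lra.
(* The weight r_i^-3 normalises the tensor of u_i to length r_i. The multiple of [G] is the
   orthogonal projection: q W over the squared norm k (k + q - 1) q. *)
have := tensor_gap (fun i => (r i)^-1 ^+ 3) (W / (k%:R * (k%:R + q - 1))) yy yG GG.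
have -> : \sum_i (r i)^-1 ^+ 3 * (q * r i ^+ 4) = q * W.
  rewrite mulr_sumr; apply: eq_bigr => i _.
  have [->|ri] := eqVneq (r i) 0; first by rewrite invr0 !expr0n/= mulr0 mul0r.
  by field.
rewrite -/M; set K := k%:R * _ => h.
have : 0 <= K * (M - 2 * (W / K) * (q * W) + (W / K) ^+ 2 * (K * q)).
  by rewrite mulr_ge0 ?(ltW K0).
rewrite -subr_ge0; congr (0 <= _); field.
by rewrite gt_eqF.
Qed.

End Quartic.

(** Gram-Schmidt: while the rank of V exceeds the number of rows found, some row of V lies outside
    their span; its orthogonal residual is normalised and added. *)
Lemma orthonormal_rows m p N (V : 'M[F]_(p, N)) : (m <= \rank V)%N ->
  exists2 Q : 'M[F]_(m, N), (Q <= V)%MS &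
    forall a b, dotF cj (row a Q) (row b Q) = (a == b)%:R.
Proof.
elim: m => [|m IH] mV.
  by exists 0; [exact: sub0mx|case].
have [Q QV QQ] := IH (ltnW mV).
have /row_subPn[i iQ] : ~~ (V <= Q)%MS.
  apply/negP => /mxrankS VQ; have := leq_trans mV (leq_trans VQ (rank_leq_row Q)).
  by rewrite ltnn.
pose v := row i V.
pose w := v - \sum_a dotF cj v (row a Q) *: row a Q.
have wQ a : dotF cj w (row a Q) = 0.
  transitivity (dotF cj v (row a Q) - \sum_b dotF cj v (row b Q) * dotF cj (row b Q) (row a Q)).
    rewrite {1}/dotF /w -/(dotF cj v (row a Q)).
    under eq_bigr do rewrite !mxE mulrBl.
    rewrite sumrB; congr (_ - _); first by apply: eq_bigr => j _; rewrite !mxE.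
    under eq_bigr do rewrite summxE mulr_suml.
    rewrite exchange_big/=; apply: eq_bigr => b _.
    rewrite {3}/dotF mulr_sumr; apply: eq_bigr => j _; rewrite !mxE; ring.
  under eq_bigr do rewrite QQ eq_sym.
  by rewrite sum_delta subrr.
have w0 : sqnorm w != 0.
  apply/eqP => w0; move/negP: iQ; apply.
  have -> : row i V = \sum_a dotF cj v (row a Q) *: row a Q.
    apply/eqP; rewrite -subr_eq0; apply/eqP/rowP => j; rewrite [RHS]mxE.
    exact: (absF_sum_eq0 w0 j).
  by apply: summx_sub => a _; apply: scalemx_sub; exact: row_sub.
have wp : 0 < sqnorm w by rewrite lt_def w0 absF_sum_ge0.
pose t := emb (Num.sqrt (sqnorm w))^-1.
pose Q' : 'M[F]_(1 + m, N) := col_mx (t *: w) Q.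
have ct : cj t = t by rewrite cj_emb.
have R0 : row (lshift m (0 : 'I_1)) Q' = t *: w.
  by apply/rowP => j; rewrite mxE col_mxEu.
have RS a : row (rshift 1 a) Q' = row a Q.
  by apply/rowP => j; rewrite mxE col_mxEd mxE.
have Q'V : (Q' <= V)%MS.
  rewrite col_mx_sub QV andbT; apply: scalemx_sub; apply: addmx_sub; first exact: row_sub.
  rewrite eqmx_opp; apply: summx_sub => a _; apply: scalemx_sub.
  exact: submx_trans (row_sub _ _) QV.
suff Q'Q' (a b : 'I_(1 + m)) : dotF cj (row a Q') (row b Q') = (a == b)%:R.
  by exists Q'.
case: (split_ordP a) => {}a ->; case: (split_ordP b) => {}b ->;
  rewrite ?(ord1 a) ?(ord1 b) /= ?R0 ?RS.
- rewrite dotFZl dotFZr ct dotF_sqnorm -!rmorphM/= mulrA -invfM -expr2.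
  by rewrite sqr_sqrtr ?(ltW wp)// mulVf// rmorph1.
- by rewrite dotFZl wQ mulr0.
- by rewrite dotFZr -dotF_cj wQ rmorph0 mulr0.
- by rewrite QQ (inj_eq (@rshift_inj _ _)).
Qed.

Lemma absF_natr n : absF n%:R = n%:R.
Proof. by rewrite -(rmorph_nat emb) absF_emb. Qed.

Lemma absF_N x : absF (- x) = absF x.
Proof.
apply/eqP; rewrite -(@eqrXn2 _ 2)//; apply/eqP/embI.
by rewrite -!mul_cj rmorphN mulrNN.
Qed.

Lemma sqnorm_unit k (x : 'rV[F]_k) : (dotF cj x x = 1) <-> (sqnorm x = 1).
Proof.
rewrite dotF_sqnorm; split=> [|->]; last by rewrite rmorph1.
by rewrite -(rmorph1 emb) => /embI.
Qed.

(** * Tight systems of unit vectors with cosines 1 and b *)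

Section Lines.
(** By [N_angle], N is the relative bound k (1 - b^2) / (1 - k b^2) for equiangular lines. *)
Variables (n k N : nat) (x : 'I_n -> 'rV[F]_k) (b : R).
Hypotheses (n0 : (0 < n)%N) (b1 : b < 1).
Hypothesis x_unit : forall i, sqnorm (x i) = 1.
Hypothesis x_angle : forall i j,
  absF (dotF cj (x i) (x j)) = 1 \/ absF (dotF cj (x i) (x j)) = b.
Hypothesis x_tight :
  forall i, k%:R * (\sum_j absF (dotF cj (x i) (x j)) ^+ 2) = n%:R.
Hypothesis kb1 : k%:R * b ^+ 2 < 1.
Hypothesis N_angle : N%:R * (1 - k%:R * b ^+ 2) = k%:R * (1 - b ^+ 2).

Let same_line i j := absF (dotF cj (x i) (x j)) == 1.

(** Unit vectors with cosine 1 differ by a scalar of modulus 1, so they make the same angles with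
    every third vector. *)
Let same_line_trans i j l : same_line i j ->
  absF (dotF cj (x i) (x l)) = absF (dotF cj (x j) (x l)).
Proof.
move=> /eqP ij; have {1}-> := unit_parallel (x_unit i) (x_unit j) ij.
by rewrite dotFZl absF_M ij mul1r.
Qed.

Let same_line_equiv : {in [set: 'I_n]%SET & &, equivalence_rel same_line}.
Proof.
move=> i j l _ _ _; split=> [|ij].
  by rewrite /same_line dotF_sqnorm x_unit rmorph1 -(rmorph1 emb) absF_emb.
by rewrite {1}/same_line (same_line_trans l ij).
Qed.

Let P := equivalence_partition same_line [set: 'I_n]%SET.
Let partP : finset.partition P [set: 'I_n]%SET.
Proof. exact: equivalence_partitionP same_line_equiv. Qed.

(** With m vectors on the line of x_i, tightness reads m (1 - b^2) + n b^2 = n / k, which [N_angle]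
    turns into m N = n. *)
Let class_card i : (#|[set j | same_line i j]%SET| * N = n)%N.
Proof.
set m := #|_|.
have S : \sum_j absF (dotF cj (x i) (x j)) ^+ 2 = m%:R * (1 - b ^+ 2) + n%:R * b ^+ 2.
  transitivity (\sum_j ((1 - b ^+ 2) * (same_line i j)%:R + b ^+ 2)).
    apply: eq_bigr => j _; rewrite /same_line.
    case: (x_angle i j) => ->; first by rewrite eqxx expr1n mulr1 subrK.
    by rewrite (lt_eqF b1) mulr0 add0r.
  rewrite big_split/= sumr_const card_ord -mulr_sumr -natr_sum -[X in _ + X]mulr_natl.
  by rewrite mulrC /m -sum1dep_card [in RHS]big_mkcond.
apply/eqP; rewrite -(@eqr_nat R) natrM; apply/eqP.
have /lt0r_neq0 h : 0 < 1 - k%:R * b ^+ 2 by rewrite subr_gt0.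
apply: (mulIf h).
by rewrite -mulrA N_angle; have := x_tight i; rewrite S; lra.
Qed.

Let pblockE i j : (j \in finset.pblock P i) = same_line i j.
Proof. by rewrite (pblock_equivalence_partition same_line_equiv) ?finset.in_setT. Qed.

Let pblock_same i j : same_line i j -> finset.pblock P i = finset.pblock P j.
Proof. by rewrite -pblockE => /finset.same_pblock ->//; case/and3P: partP. Qed.

(** All classes have the same size n / N, so there are N of them. *)
Let N_card : #|P| = N.
Proof.
pose m := #|[set j | same_line (Ordinal n0) j]%SET|.
have /andP[m0 N0] : (0 < m)%N && (0 < N)%N by rewrite -muln_gt0 class_card.
have uP : {in P, forall C : {set 'I_n}, #|C| = m}.
  move=> C PC; have [i iC] : exists i, i \in C.
    apply/finset.set0Pn; apply/eqP => C0; case/and3P: partP => _ _ /negP; apply.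
    by rewrite -C0.
  have -> : C = [set j | same_line i j]%SET.
    apply/setP => j; rewrite inE -pblockE.
    by rewrite (finset.def_pblock _ PC iC)//; case/and3P: partP.
  by apply/eqP; rewrite -(eqn_pmul2r N0) !class_card.
have := card_uniform_partition uP partP.
rewrite cardsT card_ord -{1}(class_card (Ordinal n0)) -/m mulnC => /eqP.
by rewrite eqn_pmul2r// => /eqP.
Qed.

Lemma equiangular_lines :
  (exists X : set 'rV[F]_k, X #= `I_N /\ equiangular_gen absF cj X) /\ (N %| n)%N.
Proof.
split; last by rewrite -(class_card (Ordinal n0)) dvdn_mull.
(* The system consists of one representative for each class. *)
have rep (c : 'I_#|P|) : exists i, finset.pblock P i = enum_val c.
  have /imsetP[i _ cE] := enum_valP c; exists i.
  by apply/setP => j; rewrite pblockE cE !inE.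
have [f fP] := boolp.choice rep.
have f_inj c c' : same_line (f c) (f c') -> c = c'.
  by move=> /pblock_same; rewrite !fP => /enum_val_inj.
have f_angle c c' : x (f c) <> x (f c') -> absF (dotF cj (x (f c)) (x (f c'))) = b.
  move=> cc'; case: (x_angle (f c) (f c')) => // /eqP /f_inj ccE.
  by case: cc'; rewrite ccE.
exists (range (x \o f)); split.
  rewrite -N_card; apply: card_eq_trans (card_esym card_II).
  apply: inj_card_eq => c c' _ _ /= xcc'; apply: f_inj.
  by rewrite /same_line xcc' dotF_sqnorm x_unit rmorph1 -(rmorph1 emb) absF_emb.
split.
- by move=> _ [c _ <-]; apply/sqnorm_unit; exact: x_unit.
(* Two unit vectors on one line have cosine 1, while distinct representatives have cosine b < 1. *)
- move=> _ _ [c _ <-] [c' _ <-] /= ne; apply/negP => /andP[/sub_rVP[z xz] _].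
  have zz : absF z = 1.
    apply/eqP; rewrite -(@eqrXn2 _ 2)// expr1n; apply/eqP/embI.
    have := dotF_sqnorm (x (f c)); rewrite x_unit => <-.
    by rewrite xz dotFZl dotFZr dotF_sqnorm x_unit rmorph1 mulr1 mul_cj.
  have := f_angle _ _ ne; rewrite xz dotFZl dotF_sqnorm x_unit rmorph1 mulr1 zz.
  by move=> bE; move: b1; rewrite -bE ltxx.
- by exists b => _ _ [c _ <-] [c' _ <-]; exact: f_angle.
Qed.
End Lines.

(** * From a matrix of rank d to a frame and the bound *)

Lemma absF_sum_le (absD : forall x y, absF (x + y) <= absF x + absF y)
    (I : finType) (P : pred I) (z : I -> F) :
  absF (\sum_(i | P i) z i) <= \sum_(i | P i) absF (z i).
Proof.
elim/big_ind2: _ => [|x a y c xa yc|//]; first by rewrite (absF_natr 0).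
by apply: le_trans (absD _ _) _; exact: lerD.
Qed.

(* The frame is read off an orthonormal basis of the kernel. *)
Lemma kernel_frame d k (A : 'M[F]_(d + k)) : \rank A = d ->
  exists u : 'I_(d + k) -> 'rV[F]_k, [/\
    forall i l, \sum_j A i j * dotF cj (u j) (u l) = 0,
    \sum_i sqnorm (u i) = k%:R
  & forall i, \sum_j absF (dotF cj (u i) (u j)) ^+ 2 = sqnorm (u i)].
Proof.
(* [kermx] is a left kernel, so the transpose gives the vectors killed by A. *)
move=> rA; have kA : (k <= \rank (kermx A^T))%N by rewrite mxrank_ker mxrank_tr rA addKn.
have [Q /sub_kermxP QA QQ] := orthonormal_rows kA.
have QQE a b : \sum_j Q a j * cj (Q b j) = (a == b)%:R.
  by rewrite -QQ; apply: eq_bigr => j _; rewrite !mxE.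
(* The frame vectors are the columns of Q, whose rows are orthonormal. *)
pose u i : 'rV[F]_k := \row_a Q a i.
exists u; split.
- move=> i l; transitivity (\sum_a (\sum_j Q a j * A i j) * cj (Q a l)).
    under [RHS]eq_bigr do rewrite mulr_suml.
    rewrite exchange_big/=; apply: eq_bigr => j _; rewrite mulr_sumr.
    by apply: eq_bigr => a _; rewrite !mxE; ring.
  rewrite big1// => a _; have /matrixP/(_ a i) := QA; rewrite !mxE => h.
  under eq_bigr do rewrite -(mxE trmx_key (fun x y => A y x)).
  by rewrite h mul0r.
- rewrite exchange_big/= -[in RHS](card_ord k) -sumr_const; apply: eq_bigr => a _.
  have /sqnorm_unit <- : dotF cj (row a Q) (row a Q) = 1 by rewrite QQ eqxx.
  by apply: eq_bigr => i _; rewrite !mxE.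
- move=> i; apply: embI; rewrite -mul_cj_sum -dotF_sqnorm.
  (* Idempotence of the Gram matrix, from the orthonormality of the rows of Q. *)
  transitivity (\sum_a \sum_b u i 0 a * cj (u i 0 b) * \sum_j Q b j * cj (Q a j)).
    under [RHS]eq_bigr do under eq_bigr do rewrite mulr_sumr.
    under [RHS]eq_bigr do rewrite exchange_big/=.
    rewrite [RHS]exchange_big/=; apply: eq_bigr => j _.
    rewrite dotF_cj /dotF mulr_suml; apply: eq_bigr => a _.
    by rewrite mulr_sumr; apply: eq_bigr => b _; rewrite !mxE; ring.
  apply: eq_bigr => a _; under eq_bigr do rewrite QQE eq_sym.
  by rewrite sum_delta.
Qed.

(* The trace of [A P = 0], with [P] the Gram matrix of the frame. *)
Lemma rank_le_off (absD : forall x y, absF (x + y) <= absF x + absF y)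
    k n (A : 'M[F]_n) (u : 'I_n -> 'rV[F]_k) : (forall i, A i i = 1) ->
  (forall i l, \sum_j A i j * dotF cj (u j) (u l) = 0) ->
  \sum_i sqnorm (u i) = k%:R ->
  k%:R <= offmx absF A * (\sum_i \sum_j absF (dotF cj (u i) (u j)) - k%:R).
Proof.
move=> A1 Au uk; have gE i : absF (dotF cj (u i) (u i)) = sqnorm (u i).
  by rewrite dotF_sqnorm absF_emb// absF_sum_ge0.
have split_diag i : \sum_j absF (dotF cj (u i) (u j)) =
    sqnorm (u i) + \sum_(j | j != i) absF (dotF cj (u i) (u j)).
  by rewrite (bigD1 i)//= gE.
under eq_bigr do rewrite split_diag.
rewrite big_split/= uk addrAC subrr add0r.
have -> : k%:R = absF (- \sum_i dotF cj (u i) (u i)).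
  rewrite absF_N; under eq_bigr do rewrite dotF_sqnorm.
  by rewrite -rmorph_sum uk rmorph_nat absF_natr.
(* The diagonal of A P = 0, with the term A_ii P_ii = P_ii moved across. *)
have -> : - \sum_i dotF cj (u i) (u i) =
    \sum_i \sum_(j | j != i) A i j * dotF cj (u j) (u i).
  rewrite -sumrN; apply: eq_bigr => i _.
  by have := Au i i; rewrite (bigD1 i)//= A1 mul1r => /eqP; rewrite addr_eq0 => /eqP ->; rewrite opprK.
apply: le_trans (absF_sum_le absD _ _) _; rewrite mulr_sumr; apply: ler_sum => i _.
apply: le_trans (absF_sum_le absD _ _) _; rewrite mulr_sumr; apply: ler_sum => j ji.
rewrite absF_M -(dotF_cj (u i)) absF_cj ler_wpM2r//.
by have [+ _] := offmx_le absF A (offmx_ge0 absF A); apply; rewrite // eq_sym.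
Qed.

(** Both fields at once: [eps] selects the tensor, [ha] identifies k alpha 2 b (1 + b)^2 with the
    frame constant, and N is k^2 or k (k + 1) / 2. *)
Lemma off_bound (absD : forall x y, absF (x + y) <= absF x + absF y)
    d k N (eps : bool) (b alpha : R) (A : 'M[F]_(d + k)) :
  let q := 2 + eps%:R : R in
  (eps -> forall x, cj x = x) -> (0 < k)%N -> 0 < b -> b ^+ 2 * (k%:R + q - 1) = 1 ->
  q < k%:R * (1 + 2 * b) ->
  k%:R * alpha * (2 * b * (1 + b) ^+ 2) =
    k%:R * b ^+ 2 * (1 + 2 * b) - q * b ^+ 2 + (1 + 2 * b + 3 * b ^+ 2) ->
  (N * eps.+1 = k * (k + eps))%N ->
  \rank A = d -> (forall i, A i i = 1) ->
  1 / (alpha * (d + k)%:R - 1) <= offmx absF A /\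
  (offmx absF A = 1 / (alpha * (d + k)%:R - 1) ->
   (exists X : set 'rV[F]_k, X #= `I_N /\ equiangular_gen absF cj X) /\ (N %| d + k)%N).
Proof.
move=> q cj_id k0 b0 hb hq ha hN rA A1.
have [u [Au uk ug]] := kernel_frame rA.
have n0 : (0 < d + k)%N by rewrite addn_gt0 k0 orbT.
have kR : 0 < k%:R :> R by rewrite ltr0n.
have nR : 0 < (d + k)%:R :> R by rewrite ltr0n.
set o := offmx absF A; have o0 : 0 <= o by exact: offmx_ge0.
have := rank_le_off absD A1 Au uk; rewrite -/o.
set S := \sum_i _ => kS.
pose r i := Num.sqrt (sqnorm (u i)).
have rE i : r i ^+ 2 = sqnorm (u i) by rewrite sqr_sqrtr ?absF_sum_ge0.
have r0 i : 0 <= r i by exact: sqrtr_ge0.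
have g0 i j : 0 <= absF (dotF cj (u i) (u j)) by [].
have gC i j : absF (dotF cj (u i) (u j)) = absF (dotF cj (u j) (u i)).
  by rewrite -dotF_cj absF_cj.
have g_le i j : absF (dotF cj (u i) (u j)) <= r i * r j.
  rewrite -ler_sqr ?nnegrE ?mulr_ge0// exprMn !rE.
  exact: cauchy_schwarz.
have g_row i : \sum_j absF (dotF cj (u i) (u j)) ^+ 2 = r i ^+ 2 by rewrite rE.
have r_tr : \sum_i r i ^+ 2 = k%:R by under eq_bigr do rewrite rE.
have quart := quartic_moment cj_id rE k0.
have B0 : 0 < 2 * b * (1 + b) ^+ 2.
  by rewrite mulr_gt0 ?exprn_gt0//; lra.
have S_le : S <= k%:R * alpha * (d + k)%:R.
  rewrite -(ler_pM2l B0); apply: le_trans (frame_sum_le kR b0 hb hq r0 g0 gC g_le g_row r_tr quart) _.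
  by rewrite -ha le_eqVlt; apply/orP; left; apply/eqP; ring.
have o1 : 1 <= o * (alpha * (d + k)%:R - 1).
  rewrite -(ler_pM2l kR) mulr1; apply: le_trans kS _.
  rewrite mulrCA ler_wpM2l//; lra.
(* The denominator is positive because its product with o >= 0 is at least 1. *)
have a0 : 0 < alpha * (d + k)%:R - 1.
  rewrite ltNge; apply/negP => h.
  have : o * (alpha * (d + k)%:R - 1) <= 0 by exact: mulr_ge0_le0.
  lra.
split; first by rewrite ler_pdivrMr.
move=> oE.
have o_gt0 : 0 < o by rewrite oE divr_gt0.
(* If o attains the bound, the trace inequality forces S up to its maximum. *)
have S_eq : S = k%:R * alpha * (d + k)%:R.
  apply/eqP; rewrite eq_le S_le/= -(lerD2r (- k%:R)) -(ler_pM2l o_gt0).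
  apply: le_trans kS; rewrite oE div1r.
  have -> : k%:R * alpha * (d + k)%:R - k%:R = (alpha * (d + k)%:R - 1) * k%:R by ring.
  by rewrite mulKf ?gt_eqF.
have [|r_eq g_eq] := frame_sum_eq kR b0 hb hq r0 g0 gC g_le g_row r_tr quart.
  by rewrite -/S S_eq -ha; ring.
(* The common norm: n p^2 = k. Dividing by it gives unit vectors. *)
pose p : R := Num.sqrt (k%:R / (d + k)%:R).
have p0 : 0 < p by rewrite sqrtr_gt0 divr_gt0.
have pE : p ^+ 2 = k%:R / (d + k)%:R by rewrite sqr_sqrtr// divr_ge0 ?ltW.
have rp i : r i = p.
  apply/eqP; rewrite -(@eqrXn2 _ 2) ?(ltW p0)// pE -(r_eq i) mulfK// gt_eqF//.
have xg i j : absF (dotF cj (emb p^-1 *: u i) (emb p^-1 *: u j)) =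
    absF (dotF cj (u i) (u j)) / p ^+ 2.
  rewrite dotFZl dotFZr !absF_M absF_cj absF_emb ?invr_ge0 ?(ltW p0)//.
  by rewrite mulrA mulrC -invfM -expr2.
have q2 : 2 <= q by rewrite /q lerDl.
have k1 : 1 <= k%:R :> R by rewrite ler1n.
have bb : 0 < b ^+ 2 by rewrite exprn_gt0.
have b1 : b < 1.
  rewrite -ltr_sqr ?nnegrE ?(ltW b0)// expr1n -hb -[X in X < _]mulr1.
  by rewrite ltr_pM2l//; lra.
apply: (@equiangular_lines _ _ _ (fun i => emb p^-1 *: u i) b) => //.
- move=> i; apply/sqnorm_unit; rewrite dotFZl dotFZr cj_emb dotF_sqnorm -rE rp.
  rewrite -!rmorphM/= mulrA -invfM -expr2 mulVf ?rmorph1//.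
  by rewrite expf_neq0// gt_eqF.
- move=> i j; rewrite xg; have [->|->] := g_eq i j; rewrite !rp -expr2; [left|right].
    by rewrite divff// expf_neq0// gt_eqF.
  by rewrite mulfK// expf_neq0// gt_eqF.
- move=> i; under eq_bigr do rewrite xg exprMn.
  rewrite -mulr_suml g_row rp pE.
  move: (lt0r_neq0 kR) (lt0r_neq0 nR); move: (d + k)%:R => m kn mn.
  by field; rewrite kn mn.
- by rewrite -[X in _ < X]hb mulrC ltr_pM2l//; lra.
- have hN' : N%:R * (1 + eps%:R) = k%:R * (k%:R + eps%:R) :> R.
    by rewrite nat1r -natrD -!natrM hN.
  (* By [hb] both factors are multiples of b^2, so the relation for N reduces to [hN]. *)
  have -> : 1 - k%:R * b ^+ 2 = (1 + eps%:R) * b ^+ 2 by move: hb; rewrite /q; lra.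
  have -> : 1 - b ^+ 2 = (k%:R + eps%:R) * b ^+ 2 by move: hb; rewrite /q; lra.
  by rewrite !mulrA hN'.
Qed.

End HermitianField.

(** * The two fields *)

(** The hypothesis [ha] of [off_bound] at q = 2 and b = 1 / w. Eliminating k leaves a rational
    identity in w. *)
Lemma alphaC_identity (R : realType) (k w : R) : 0 < k -> 0 < w -> w ^+ 2 = k + 1 ->
  k * (((k - 1) * w + 1) / k ^+ 2) * (2 * w^-1 * (1 + w^-1) ^+ 2) =
  k * w^-1 ^+ 2 * (1 + 2 * w^-1) - 2 * w^-1 ^+ 2 + (1 + 2 * w^-1 + 3 * w^-1 ^+ 2).
Proof.
move=> k0 w0 wk; have -> : k = w ^+ 2 - 1 by lra.
by field; rewrite gt_eqF//=; lra.
Qed.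

Lemma alphaR_identity (R : realType) (k w : R) : 0 < k -> 0 < w -> w ^+ 2 = k + 2 ->
  k * (((k - 1) * w + 2) / (k * (k + 1))) * (2 * w^-1 * (1 + w^-1) ^+ 2) =
  k * w^-1 ^+ 2 * (1 + 2 * w^-1) - 3 * w^-1 ^+ 2 + (1 + 2 * w^-1 + 3 * w^-1 ^+ 2).
Proof.
move=> k0 w0 wk; have -> : k = w ^+ 2 - 2 by lra.
by field; rewrite !gt_eqF//=; lra.
Qed.

Lemma eqz_mod_opp_dvdn (d k N : nat) : (N %| d + k)%N -> (d%:Z = - k%:Z %[mod N%:Z])%Z.
Proof. by move=> h; apply/eqP; rewrite eqz_mod_dvd opprK. Qed.

Section Fields.
Set Implicit Arguments.
Unset Strict Implicit.
Variable R : realType.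

Lemma normc_ge0 (z : R[i]) : 0 <= Normc.normc z.
Proof. by case: z => a b; exact: sqrtr_ge0. Qed.

Lemma mul_conjc (z : R[i]) : z * conjc z = real_complex R (Normc.normc z ^+ 2).
Proof. by rewrite -sqr_normc rmorphXn. Qed.

Lemma offC_bound d k (A : 'M[R[i]]_(d + k)) (o := offmx (@Normc.normc R) A) :
  (0 < k)%N -> \rank A = d -> (forall i, A i i = 1) ->
  1 / (alphaC R k * (d + k)%:R - 1) <= o /\
  (o = 1 / (alphaC R k * (d + k)%:R - 1) ->
    (exists X : set 'rV[R[i]]_k, X #= `I_(k ^ 2) /\ equiangularC X) /\ (k ^ 2 %| d + k)%N).
Proof.
move=> k0 rA A1; have kR : 1 <= k%:R :> R by rewrite ler1n.
pose w : R := Num.sqrt (k%:R + 1).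
have w0 : 0 < w by rewrite sqrtr_gt0; lra.
have wk : w ^+ 2 = k%:R + 1 by rewrite sqr_sqrtr; lra.
have b0 : 0 < w^-1 by rewrite invr_gt0.
have hb : w^-1 ^+ 2 * (k%:R + (2 + false%:R) - 1) = 1.
  have -> : k%:R + (2 + false%:R) - 1 = w ^+ 2 :> R by rewrite wk /=; lra.
  by rewrite exprVn mulVf// expf_neq0// gt_eqF.
apply: (@off_bound R R[i] (@Normc.normc R) conjc (real_complex R)
  normc_ge0 (@conjcK R) _ mul_conjc (@le_normcD R) d k (k ^ 2) false w^-1) => //.
- by move=> x; rewrite /= oppr0.
(* The condition 2 < k (1 + 2 b) is clear for k >= 2; for k = 1 it holds as b^2 = 1/2 gives 2 b >
   1. *)
- have [k1|k2] : k%:R = 1 :> R \/ 2 <= k%:R :> R.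
    by case: k k0 {A o rA A1 kR w w0 wk b0 hb} => [//|[|k] _]; [left|right; rewrite ler_nat].
  + have : w^-1 ^+ 2 * 2 = 1 by move: hb; rewrite k1 /=; lra.
    by rewrite k1 /=; nra.
  + by have : 0 < k%:R * w^-1; [rewrite mulr_gt0//; lra|rewrite /=; lra].
- rewrite /alphaC -/w alphaC_identity//; last by lra.
  by rewrite (_ : 2 + false%:R = 2)//= addr0.
- by rewrite muln1 addn0 -mulnn.
Qed.

Lemma offR_bound d k (A : 'M[R]_(d + k)) (o := offmx (fun x : R => `|x|) A) :
  (0 < k)%N -> \rank A = d -> (forall i, A i i = 1) ->
  1 / (alphaR R k * (d + k)%:R - 1) <= o /\
  (o = 1 / (alphaR R k * (d + k)%:R - 1) ->
    (exists X : set 'rV[R]_k, X #= `I_('C(k.+1, 2)) /\ equiangularR X)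
    /\ ('C(k.+1, 2) %| d + k)%N).
Proof.
move=> k0 rA A1; have kR : 1 <= k%:R :> R by rewrite ler1n.
have mul_idfun (z : R) : z * idfun z = idfun (`|z| ^+ 2) by rewrite /= real_normK ?num_real.
(* For [k = 1] the orthogonal invariant yields too weak a bound, and the
   unitary one, with [alphaC 1 = alphaR 1], applies. *)
have [k1|k2] : k = 1%N \/ (1 < k)%N.
  by case: k k0 {A o rA A1 kR} => [//|[|k] _]; [left|right].
  subst k.
  pose w : R := Num.sqrt (1 + 1).
  have w0 : 0 < w by rewrite sqrtr_gt0; lra.
  have wk : w ^+ 2 = 1 + 1 by rewrite sqr_sqrtr; lra.
  have b0 : 0 < w^-1 by rewrite invr_gt0.
  have b2 : w^-1 ^+ 2 * 2 = 1 by rewrite exprVn wk; field.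
  (* Here N = 1 is both 1^2 and 'C(2, 2). *)
  apply: (@off_bound R R (fun x => `|x|) idfun idfun _ _ _ mul_idfun _ d 1 1 false w^-1) => //.
  + exact: ler_normD.
  + by rewrite /=; lra.
  + by rewrite /=; nra.
  + have -> : alphaR R 1 = ((1 - 1) * w + 1) / 1 ^+ 2 by rewrite /alphaR; field.
    rewrite (_ : 2 + false%:R = 2) ?addr0//.
    exact: (@alphaC_identity R 1 w ltr01 w0 wk).
pose w : R := Num.sqrt (k%:R + 2).
have w0 : 0 < w by rewrite sqrtr_gt0; lra.
have wk : w ^+ 2 = k%:R + 2 by rewrite sqr_sqrtr; lra.
have b0 : 0 < w^-1 by rewrite invr_gt0.
have hb : w^-1 ^+ 2 * (k%:R + (2 + true%:R) - 1) = 1.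
  have -> : k%:R + (2 + true%:R) - 1 = w ^+ 2 :> R by rewrite wk /=; lra.
  by rewrite exprVn mulVf// expf_neq0// gt_eqF.
apply: (@off_bound R R (fun x => `|x|) idfun idfun _ _ _ mul_idfun _ d k _ true w^-1) => //.
- exact: ler_normD.
(* The condition 3 < k (1 + 2 b) is clear for k >= 3; for k = 2, b = 1/2 gives 3 < 4. *)
- have [k1|k3] : k%:R = 2 :> R \/ 3 <= k%:R :> R.
    by case: k k2 {A o rA A1 k0 kR w w0 wk b0 hb} => [//|[//|[|k]] _]; [left|right; rewrite ler_nat].
  + have : w^-1 ^+ 2 * 4 = 1 by move: hb; rewrite k1 /=; lra.
    by rewrite k1 /=; nra.
  + by have : 0 < k%:R * w^-1; [rewrite mulr_gt0//; lra|rewrite /=; lra].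
- rewrite /alphaR -/w alphaR_identity//; last by lra.
  by rewrite (_ : 2 + true%:R = 3)//=; ring.
- by rewrite mulnC -mul_bin_diag bin1 mulnC addn1.
Qed.

End Fields.

Theorem theorem1p2 (R : realType) (d k : nat) (hd : (0 < d)%N) (hk : (0 < k)%N) :
  (offR R d k >= 1 / (alphaR R k * (d + k)%:R - 1)
   /\ (offR R d k = 1 / (alphaR R k * (d + k)%:R - 1) ->
       (exists X : set 'rV[R]_k, X #= `I_('C(k.+1, 2)) /\ equiangularR X)
       /\ (d%:Z = - k%:Z %[mod ('C(k.+1, 2))%:Z])%Z))
  /\
  (offC R d k >= 1 / (alphaC R k * (d + k)%:R - 1)
   /\ (offC R d k = 1 / (alphaC R k * (d + k)%:R - 1) ->
       (exists X : set 'rV[R[i]]_k, X #= `I_(k ^ 2) /\ equiangularC X)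
       /\ (d%:Z = - k%:Z %[mod (k ^ 2)%N%:Z])%Z)).

Proof.
split; split.
(* Since d > 0 the infimum is attained, so the bound and its equality case are read off an optimal
   matrix. *)
- by have [[A [rA A1] <-] _] := @offR_min R d k hd; case: (offR_bound hk rA A1).
- have [[A [rA A1] <-] _] := @offR_min R d k hd; case: (offR_bound hk rA A1) => _ h /h[hX /eqz_mod_opp_dvdn hN].
  by split.
- by have [[A [rA A1] <-] _] := @offC_min R d k hd; case: (offC_bound hk rA A1).
- have [[A [rA A1] <-] _] := @offC_min R d k hd; case: (offC_bound hk rA A1) => _ h /h[hX /eqz_mod_opp_dvdn hN].
  by split.
Qed.
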